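(* Let $\mathcal{C}$ be an abstract class of lattices and let $P$ be a partial lattice. Consider the statements: (i) $P$ is ideal-projective with respect to $\mathcal{C}$; (ii) $P$ is $\mathbf{wD}_{\vee}$-projective with respect to $\mathcal{C}$; (iii) $P$ is $\mathbf{wD}$-projective with respect to $\mathcal{C}$; (iv) $P$ is sharply transferable with respect to $\mathcal{C}$; (v) $P$ is transferable with respect to $\mathcal{C}$. Then: (a) The implications (i)$\Rightarrow$(ii)$\Rightarrow$(iii) and (iv)$\Rightarrow$(v) always hold. (b) If $P$ is finite and $\mathcal{C}$ is closed under sublattices, images under weakly distributive lattice homomorphisms, and ultraproducts, then (iii) implies (i). (c) If $P$ is finite, then (i) implies (iv). (d) If $P\in\mathcal{C}$ and $\mathcal{C}$ is closed under sublattices and nonempty finite products, then (iv) implies (iii).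
   Context: An abstract class is one closed under isomorphic copies. A partial lattice is a poset $(P,\leq)$ with partial functions $\bigvee,\bigwedge$ from the set of nonempty finite subsets of $P$ to $P$ such that $a=\bigvee X$ implies $\{p: p\geq a\}=\bigcap_{x\in X}\{p:p\geq x\}$, and dually $a=\bigwedge X$ implies $\{p:p\leq a\}=\bigcap_{x\in X}\{p:p\leq x\}$. Lattices are identified with partial lattices where both operations are everywhere defined. A homomorphism of partial lattices $f\colon P\to Q$ is an isotone map such that $a=\bigvee X$ implies $f(a)=\bigvee f[X]$ and $a=\bigwedge X$ implies $f(a)=\bigwedge f[X]$; it is an embedding if moreover $f(a)\leq f(b)$ implies $a\leq b$. An ideal of a lattice $L$ is a nonempty subset $I$ such that $x\vee y\in I$ iff $x,y\in I$; $\mathrm{Id}\,L$ is the lattice of ideals ordered by inclusion. A join-homomorphism $f\colon K\to L$ is weakly distributive if whenever $f(x)\leq y_0\vee y_1$ there are $x_0,x_1\in K$ with $x\leq x_0\vee x_1$ and $f(x_i)\leq y_i$. $\mathbf{wD}$ (resp. $\mathbf{wD}_\vee$) is the class of all surjective weakly distributive lattice homomorphisms (resp. surjective weakly distributive join-homomorphisms between lattices). For a class $\mathbf{F}$ of surjective maps between lattices, $P$ is $\mathbf{F}$-projective with respect to $\mathcal{C}$ if for all $K,L\in\mathcal{C}$, every $h\colon L\to K$ in $\mathbf{F}$ and every homomorphism of partial lattices $f\colon P\to K$, there is a homomorphism of partial lattices $g\colon P\to L$ with $f=h\circ g$. A choice function for a set-valued map $\varphi$ on $P$ is a map $f$ with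 $f(x)\in\varphi(x)$ for all $x$. $P$ is ideal-projective with respect to $\mathcal{C}$ if for every $L\in\mathcal{C}$, every homomorphism of partial lattices $\varphi\colon P\to\mathrm{Id}\,L$ and every choice function $f_0$ for $\varphi$, there is a choice function $f\colon P\to L$ for $\varphi$ which is a homomorphism of partial lattices with $f_0\leq f$ pointwise. $P$ is sharply transferable with respect to $\mathcal{C}$ if for every $L\in\mathcal{C}$ and every embedding of partial lattices $\varphi\colon P\to\mathrm{Id}\,L$ there is a choice function $f\colon P\to L$ for $\varphi$ which is a homomorphism of partial lattices such that $f(x)\in\varphi(y)$ implies $x\leq y$ for all $x,y\in P$. $P$ is transferable with respect to $\mathcal{C}$ if for every $L\in\mathcal{C}$, whenever $P$ embeds into $\mathrm{Id}\,L$ as a partial lattice, it also embeds into $L$ as a partial lattice. *)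

(* Defs.v *)
From HB Require Import structures.
From mathcomp Require Import all_boot all_order finmap.
From mathcomp Require Import boolp classical_sets functions cardinality filter.

Set Implicit Arguments.
Unset Strict Implicit.
Unset Printing Implicit Defensive.

Import Order.LTheory.
Local Open Scope classical_set_scope.
Local Open Scope order_scope.
Local Open Scope quotient_scope.

(* The partial operations are defined on nonempty finite subsets only; they
   are encoded as [option]-valued functions on {fset P} that are undefined at
   the empty set. *)
Record partialLattice (d : Order.disp_t) := PartialLattice {
  plat_sort :> porderType d ;
  pjoin : {fset plat_sort} -> option plat_sort ;
  pmeet : {fset plat_sort} -> option plat_sort ;
  pjoin0 : pjoin fset0 = None ;
  pmeet0 : pmeet fset0 = None ;
  pjoinP : forall X a, pjoin X = Some a ->
    [set p | a <= p] = \bigcap_(x in [set` X]) [set p | x <= p] ;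
  pmeetP : forall X a, pmeet X = Some a ->
    [set p | p <= a] = \bigcap_(x in [set` X]) [set p | p <= x]
}.

Section LatticeAsPartialLattice.
Context {d : Order.disp_t} (L : latticeType d).
Implicit Types (X : {fset L}) (a : L).

(* The value does not depend on the enumeration of X: see [lat_joinP] and
   [lat_meetP]. *)
Definition lat_join X : option L :=
  if enum_fset X is x :: s then Some (foldr Order.join x s) else None.

Definition lat_meet X : option L :=
  if enum_fset X is x :: s then Some (foldr Order.meet x s) else None.

Lemma lat_join0 : lat_join fset0 = None.
Proof.
rewrite /lat_join; case E: (enum_fset _) => [//|x s].
have : x \in enum_fset (fset0 : {fset L}) by rewrite E mem_head.
by rewrite -[_ \in _]/(x \in (fset0 : {fset L})) in_fset0.
Qed.

Lemma lat_meet0 : lat_meet fset0 = None.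
Proof.
rewrite /lat_meet; case E: (enum_fset _) => [//|x s].
have : x \in enum_fset (fset0 : {fset L}) by rewrite E mem_head.
by rewrite -[_ \in _]/(x \in (fset0 : {fset L})) in_fset0.
Qed.

Lemma foldr_joinE (x : L) s p :
  (foldr Order.join x s <= p) = all (<= p) (x :: s).
Proof. by elim: s => [|y s IH] /=; rewrite ?andbT // leUx IH /= andbCA. Qed.

Lemma foldr_meetE (x : L) s p :
  (p <= foldr Order.meet x s) = all (>= p) (x :: s).
Proof. by elim: s => [|y s IH] /=; rewrite ?andbT // lexI IH /= andbCA. Qed.

Lemma lat_joinP X a : lat_join X = Some a ->
  [set p | a <= p] = \bigcap_(x in [set` X]) [set p | x <= p].
Proof.
rewrite /lat_join; case E: (enum_fset X) => [//|x s] [<-].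
have memX y : (y \in X) = (y \in x :: s) by rewrite -E.
apply/seteqP; split=> p /=; rewrite foldr_joinE.
  by move=> /allP h y /=; rewrite memX; exact: h.
by move=> h; apply/allP => y ys; apply: h; rewrite /= memX.
Qed.

Lemma lat_meetP X a : lat_meet X = Some a ->
  [set p | p <= a] = \bigcap_(x in [set` X]) [set p | p <= x].
Proof.
rewrite /lat_meet; case E: (enum_fset X) => [//|x s] [<-].
have memX y : (y \in X) = (y \in x :: s) by rewrite -E.
apply/seteqP; split=> p /=; rewrite foldr_meetE.
  by move=> /allP h y /=; rewrite memX; exact: h.
by move=> h; apply/allP => y ys; apply: h; rewrite /= memX.
Qed.

Definition plat_of_lattice : partialLattice d :=
  PartialLattice lat_join0 lat_meet0 lat_joinP lat_meetP.

End LatticeAsPartialLattice.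

Section PartialLatticeMorphisms.
Context {d d' : Order.disp_t} (P : partialLattice d) (Q : partialLattice d').
Implicit Type f : P -> Q.

Definition plat_hom f : Prop :=
  [/\ {homo f : x y / x <= y},
      forall X a, pjoin X = Some a -> pjoin (f @` X)%fset = Some (f a) &
      forall X a, pmeet X = Some a -> pmeet (f @` X)%fset = Some (f a)].

Definition plat_embedding f : Prop :=
  plat_hom f /\ forall a b, f a <= f b -> a <= b.

End PartialLatticeMorphisms.

Definition plat_iso {d d' : Order.disp_t} (P : partialLattice d)
    (Q : partialLattice d') : Prop :=
  exists (f : P -> Q) (g : Q -> P),
    [/\ plat_hom f, plat_hom g, cancel f g & cancel g f].

Section Ideals.
Context {d : Order.disp_t} (L : latticeType d).

Definition is_ideal (I : set L) : Prop :=
  I !=set0 /\ forall x y, I (x `|` y) <-> I x /\ I y.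

Record Id := Ideal { ideal_set :> set L ; idealP : is_ideal ideal_set }.

HB.instance Definition _ := gen_eqMixin Id.
HB.instance Definition _ := gen_choiceMixin Id.

Implicit Types A B : Id.

Lemma ideal_inj : injective ideal_set.
Proof. by case=> [A pA] [B pB] /= AB; subst B; congr Ideal; exact: Prop_irrelevance. Qed.

Lemma ideal_le A x y : x <= y -> ideal_set A y -> ideal_set A x.
Proof. by move=> xy; have [_ h] := idealP A; rewrite -(join_r xy) h => -[]. Qed.

Lemma ideal_join A x y : ideal_set A x -> ideal_set A y -> ideal_set A (x `|` y).
Proof. by have [_ h] := idealP A; rewrite h. Qed.

Definition ideal_leb A B : bool := `[< ideal_set A `<=` ideal_set B >].

Lemma ideal_leb_refl : reflexive ideal_leb.
Proof. by move=> A; apply/asboolP. Qed.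

Lemma ideal_leb_anti : antisymmetric ideal_leb.
Proof.
by move=> A B /andP[/asboolP AB /asboolP BA]; apply/ideal_inj/seteqP; split.
Qed.

Lemma ideal_leb_trans : transitive ideal_leb.
Proof.
by move=> B A C /asboolP AB /asboolP BC; apply/asboolP; exact: subset_trans BC.
Qed.

HB.instance Definition _ := Order.Le_isPOrder.Build d Id
  ideal_leb_refl ideal_leb_anti ideal_leb_trans.

Lemma is_ideal_meet A B : is_ideal (A `&` B)%classic.
Proof.
have [[a Aa] hA] := idealP A; have [[b Bb] hB] := idealP B.
split=> [|x y]; last by rewrite /setI /= hA hB; tauto.
by exists (a `&` b); split; [apply: ideal_le Aa; exact: leIl
                            |apply: ideal_le Bb; exact: leIr].
Qed.

Lemma is_ideal_join A B :
  is_ideal [set z | exists x y, [/\ ideal_set A x, ideal_set B y & z <= x `|` y]].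
Proof.
have [[a Aa] _] := idealP A; have [[b Bb] _] := idealP B.
split=> [|x y]; first by exists (a `|` b), a, b.
split=> [[u [v [Au Bv]]]|[[u [v [Au Bv xuv]]] [u' [v' [Au' Bv' yuv]]]]].
  by rewrite leUx => /andP[xuv yuv]; split; exists u, v.
exists (u `|` u'), (v `|` v'); split; [exact: ideal_join|exact: ideal_join|].
by rewrite joinACA leU2.
Qed.

Definition ideal_meet A B : Id := Ideal (is_ideal_meet A B).
Definition ideal_joinI A B : Id := Ideal (is_ideal_join A B).

Lemma ideal_meetP A B C : (A <= ideal_meet B C) = (A <= B) && (A <= C).
Proof.
apply/asboolP/andP => [h|[/asboolP AB /asboolP AC] x Ax].
  by split; apply/asboolP => x /h[].
by split; [exact: AB|exact: AC].
Qed.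

Lemma ideal_joinP A B C : (ideal_joinI A B <= C) = (A <= C) && (B <= C).
Proof.
apply/asboolP/andP => [h|[/asboolP AC /asboolP BC] z [x [y [Ax By zxy]]]].
  have [[a Aa] _] := idealP A; have [[b Bb] _] := idealP B.
  split; apply/asboolP => x xI; apply: h.
    by exists x, b; split=> //; exact: leUl.
  by exists a, x; split=> //; exact: leUr.
by apply: ideal_le zxy _; apply: ideal_join; [exact: AC|exact: BC].
Qed.

HB.instance Definition _ := Order.POrder_MeetJoin_isLattice.Build d Id
  ideal_meetP ideal_joinP.

End Ideals.

Section LatticeMorphisms.
Context {d : Order.disp_t} {L K : latticeType d}.
Implicit Type h : L -> K.

Definition lattice_hom h : Prop :=
  Order.join_morphism h /\ Order.meet_morphism h.

Definition weakly_distributive h : Prop :=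
  forall x y0 y1, h x <= y0 `|` y1 ->
    exists x0 x1, [/\ x <= x0 `|` x1, h x0 <= y0 & h x1 <= y1].

Definition surjective h : Prop := forall y, exists x, h x = y.

Definition wD h : Prop :=
  [/\ surjective h, lattice_hom h & weakly_distributive h].

Definition wDj h : Prop :=
  [/\ surjective h, Order.join_morphism h & weakly_distributive h].

End LatticeMorphisms.

Section Products.
Context {d : Order.disp_t} {I : Type} (L : I -> latticeType d).

Definition prodLattice : Type := forall i, L i.

HB.instance Definition _ := gen_eqMixin prodLattice.
HB.instance Definition _ := gen_choiceMixin prodLattice.

Implicit Types x y z : prodLattice.

Definition prod_le x y : bool := `[< forall i, x i <= y i >].
Definition prod_meet x y : prodLattice := fun i => x i `&` y i.
Definition prod_join x y : prodLattice := fun i => x i `|` y i.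

Lemma prod_le_refl : reflexive prod_le.
Proof. by move=> x; apply/asboolP. Qed.

Lemma prod_le_anti : antisymmetric prod_le.
Proof.
move=> x y /andP[/asboolP xy /asboolP yx].
by apply: functional_extensionality_dep => i; apply/le_anti; rewrite xy yx.
Qed.

Lemma prod_le_trans : transitive prod_le.
Proof.
move=> y x z /asboolP xy /asboolP yz.
by apply/asboolP => i; exact: le_trans (yz i).
Qed.

HB.instance Definition _ := Order.Le_isPOrder.Build d prodLattice
  prod_le_refl prod_le_anti prod_le_trans.

Lemma prod_meetP x y z : (x <= prod_meet y z) = (x <= y) && (x <= z).
Proof.
apply/asboolP/andP => [h|[/asboolP xy /asboolP xz] i].
  by split; apply/asboolP => i; have := h i; rewrite lexI => /andP[].
by rewrite lexI xy xz.
Qed.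

Lemma prod_joinP x y z : (prod_join x y <= z) = (x <= z) && (y <= z).
Proof.
apply/asboolP/andP => [h|[/asboolP xz /asboolP yz] i].
  by split; apply/asboolP => i; have := h i; rewrite leUx => /andP[].
by rewrite leUx xz yz.
Qed.

HB.instance Definition _ := Order.POrder_MeetJoin_isLattice.Build d prodLattice
  prod_meetP prod_joinP.

End Products.

Section Ultraproducts.
Context {d : Order.disp_t} {I : Type} (U : set_system I) (FU : UltraFilter U).
Variable L : I -> latticeType d.
Implicit Types x y z : prodLattice L.

Let FF : Filter U. Proof. exact: _. Qed.

Definition ultra_eq x y : bool := `[< U [set i | x i = y i] >].

Lemma ultra_eq_refl : reflexive ultra_eq.
Proof. by move=> x; apply/asboolP; apply: filterS filterT. Qed.

Lemma ultra_eq_sym : symmetric ultra_eq.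
Proof. by move=> x y; apply/asboolP/asboolP; apply: filterS. Qed.

Lemma ultra_eq_trans : transitive ultra_eq.
Proof.
move=> y x z /asboolP xy /asboolP yz; apply/asboolP.
by apply: filterS2 xy yz => i /= ->.
Qed.

Definition ultra_equiv : equiv_rel (prodLattice L) :=
  EquivRel ultra_eq ultra_eq_refl ultra_eq_sym ultra_eq_trans.

Definition ultraproduct : Type := {eq_quot ultra_equiv}.

HB.instance Definition _ := Choice.on ultraproduct.
HB.instance Definition _ := EqQuotient.on ultraproduct.

Implicit Types u v w : ultraproduct.

Definition ultra_le u v : bool := `[< U [set i | repr u i <= repr v i] >].
Definition ultra_meet u v : ultraproduct := \pi_ultraproduct (repr u `&` repr v).
Definition ultra_join u v : ultraproduct := \pi_ultraproduct (repr u `|` repr v).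

Lemma ultra_piP x y :
  (\pi_ultraproduct x = \pi_ultraproduct y) <-> U [set i | x i = y i].
Proof.
by split=> [/eqmodP/asboolP|h]; [|apply/eqmodP/asboolP].
Qed.

Lemma ultra_repr x : U [set i | repr (\pi_ultraproduct x) i = x i].
Proof. by apply/ultra_piP; rewrite reprK. Qed.

Lemma ultra_le_refl : reflexive ultra_le.
Proof. by move=> u; apply/asboolP; apply: filterS filterT => i /=. Qed.

Lemma ultra_le_anti : antisymmetric ultra_le.
Proof.
move=> u v /andP[/asboolP uv /asboolP vu].
rewrite -(reprK u) -(reprK v); apply/ultra_piP.
by apply: filterS2 uv vu => i /= uv vu; apply/le_anti; rewrite uv vu.
Qed.

Lemma ultra_le_trans : transitive ultra_le.
Proof.
move=> v u w /asboolP uv /asboolP vw; apply/asboolP.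
by apply: filterS2 uv vw => i /=; exact: le_trans.
Qed.

HB.instance Definition _ := Order.Le_isPOrder.Build d ultraproduct
  ultra_le_refl ultra_le_anti ultra_le_trans.

Lemma ultra_meetP u v w : (u <= ultra_meet v w) = (u <= v) && (u <= w).
Proof.
have vwE := ultra_repr (repr v `&` repr w).
apply/asboolP/andP => [h|[/asboolP uv /asboolP uw]].
  by split; apply/asboolP; apply: filterS2 h vwE => i /= + E;
    rewrite E lexI => /andP[].
have uvw : U [set i | repr u i <= repr v i `&` repr w i].
  by apply: filterS2 uv uw => i /= ? ?; rewrite lexI; apply/andP.
by apply: filterS2 uvw vwE => i /= + E; rewrite E.
Qed.

Lemma ultra_joinP u v w : (ultra_join u v <= w) = (u <= w) && (v <= w).
Proof.
have uvE := ultra_repr (repr u `|` repr v).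
apply/asboolP/andP => [h|[/asboolP uw /asboolP vw]].
  by split; apply/asboolP; apply: filterS2 h uvE => i /= + E;
    rewrite E leUx => /andP[].
have uvw : U [set i | repr u i `|` repr v i <= repr w i].
  by apply: filterS2 uw vw => i /= ? ?; rewrite leUx; apply/andP.
by apply: filterS2 uvw uvE => i /= + E; rewrite E.
Qed.

HB.instance Definition _ := Order.POrder_MeetJoin_isLattice.Build d ultraproduct
  ultra_meetP ultra_joinP.

End Ultraproducts.

(* A class of lattices is a predicate on [latticeType d]. Fixing the display
   [d] is harmless: displays are phantom arguments. *)
Section ClosureProperties.
Context {d : Order.disp_t} (C : latticeType d -> Prop).

Definition abstract_class : Prop :=
  forall (L K : latticeType d) (f : L -> K),
    C L -> lattice_hom f -> bijective f -> C K.

(* [latticeType] allows the empty lattice; the requirement [inhabited M] makes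
   sublattices nonempty. *)
Definition closed_sublattices : Prop :=
  forall (L : latticeType d) (S : pred L) (M : subLattice S d),
    C L -> inhabited M -> C M.

Definition closed_wD_images : Prop :=
  forall (L K : latticeType d) (h : L -> K), C L -> wD h -> C K.

Definition closed_ultraproducts : Prop :=
  forall (I : Type) (U : set_system I) (FU : UltraFilter U)
    (L : I -> latticeType d),
    (forall i, C (L i)) -> C (ultraproduct FU L).

Definition closed_finite_products : Prop :=
  forall (I : finType) (L : I -> latticeType d),
    (0 < #|I|)%N -> (forall i, C (L i)) -> C (prodLattice L).

End ClosureProperties.

Section Projectivity.
Context {d d' : Order.disp_t} (P : partialLattice d').

Definition projective (F : forall L K : latticeType d, (L -> K) -> Prop)
    (C : latticeType d -> Prop) : Prop :=
  forall (K L : latticeType d) (h : L -> K)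
    (f : P -> plat_of_lattice K),
    C K -> C L -> F L K h -> plat_hom f ->
    exists g : P -> plat_of_lattice L, plat_hom g /\ f = h \o g.

Definition choice_function (L : latticeType d) (phi : P -> Id L)
    (f : P -> L) : Prop :=
  forall x, f x \in ideal_set (phi x).

Definition ideal_projective (C : latticeType d -> Prop) : Prop :=
  forall (L : latticeType d) (phi : P -> plat_of_lattice (Id L)) (f0 : P -> L),
    C L -> plat_hom phi -> choice_function phi f0 ->
    exists f : P -> plat_of_lattice L,
      [/\ choice_function phi f, plat_hom f & forall x, f0 x <= f x].

Definition sharply_transferable (C : latticeType d -> Prop) : Prop :=
  forall (L : latticeType d) (phi : P -> plat_of_lattice (Id L)),
    C L -> plat_embedding phi ->
    exists f : P -> plat_of_lattice L,
      [/\ choice_function phi f, plat_hom f &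
          forall x y, f x \in ideal_set (phi y) -> x <= y].

Definition transferable (C : latticeType d -> Prop) : Prop :=
  forall L : latticeType d, C L ->
    (exists phi : P -> plat_of_lattice (Id L), plat_embedding phi) ->
    exists f : P -> plat_of_lattice L, plat_embedding f.

(* The membership P \in C, lattices being identified with the partial lattices
   whose operations are everywhere defined; isomorphism instead of equality
   makes no difference for an abstract class. *)
Definition plat_in_class (C : latticeType d -> Prop) : Prop :=
  exists L : latticeType d, C L /\ plat_iso P (plat_of_lattice L).

End Projectivity.

(* Main.v *)
(**
(i) => (ii): for [h] in wD_vee and [f : P -> K], weak distributivity makes
[x |-> {l | h l <= f x}] a homomorphism from [P] to [Id L], and a lifting that
dominates a section of [f] along [h] is mapped by [h] exactly onto [f].

(iii) => (i): index by the finite subsets of [L] and take an ultrafilter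
containing all the cones. In the ultrapower, the classes of isotone functions
[x] form a sublattice [M], and sending [x] to the ideal generated by its range
is a surjective weakly distributive lattice homomorphism from [M] onto [Id L].
Hence [Id L] is in the class, a homomorphism [P -> Id L] lifts to [M], and
evaluating representatives of the lifting at one large enough index preserves
the finitely many relations of the finite [P].

(iv) => (iii): in the pullback [M = {(q, l) | f q = h l}] of [P * L], the ideals
[{(q, l) | q <= p}] define an embedding of [P] into [Id M]. Sharpness
forces the first component of a transferring map to be the identity, so its
second component lifts [f].
*)

Require Import Defs.
From HB Require Import structures.
From mathcomp Require Import all_boot all_order finmap.
From mathcomp Require Import boolp classical_sets functions cardinality filter.

Local Open Scope classical_set_scope.

Set Implicit Arguments.
Unset Strict Implicit.
Unset Printing Implicit Defensive.

(** * Homomorphisms from a partial lattice into a lattice *)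

Section HomToLattice.
Import Order.LTheory.
Local Open Scope order_scope.
Context {d d' : Order.disp_t} (P : partialLattice d') (L : latticeType d).
Implicit Types (f : P -> plat_of_lattice L) (X : {fset P}) (Y : {fset L}).

Lemma le_foldr_join (x : L) s z : z \in x :: s -> z <= foldr Order.join x s.
Proof. by move: z; apply/allP; rewrite -foldr_joinE. Qed.

Lemma ge_foldr_meet (x : L) s z : z \in x :: s -> foldr Order.meet x s <= z.
Proof. by move: z; apply/allP; rewrite -foldr_meetE. Qed.

Lemma lat_join_lub Y a : Y != fset0 ->
  (forall p, a <= p <-> forall y, y \in Y -> y <= p) -> lat_join Y = Some a.
Proof.
move=> Y0 lub; rewrite /lat_join; case E: (enum_fset Y) => [|y s].
  by case/fset0Pn: Y0 => z; rewrite -[z \in Y]/(z \in enum_fset Y) E.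
congr Some; apply/le_anti/andP; split.
  by rewrite foldr_joinE -E; apply/allP => z zY; apply: (proj1 (lub a)) zY.
apply: (proj2 (lub _)) => z; rewrite -[z \in Y]/(z \in enum_fset Y) E => zs.
exact: le_foldr_join.
Qed.

Lemma lat_meet_glb Y a : Y != fset0 ->
  (forall p, p <= a <-> forall y, y \in Y -> p <= y) -> lat_meet Y = Some a.
Proof.
move=> Y0 glb; rewrite /lat_meet; case E: (enum_fset Y) => [|y s].
  by case/fset0Pn: Y0 => z; rewrite -[z \in Y]/(z \in enum_fset Y) E.
congr Some; apply/le_anti/andP; split; last first.
  by rewrite foldr_meetE -E; apply/allP => z zY; apply: (proj1 (glb a)) zY.
apply: (proj2 (glb _)) => z; rewrite -[z \in Y]/(z \in enum_fset Y) E => zs.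
exact: ge_foldr_meet.
Qed.

Lemma pjoin_neq0 X a : pjoin X = Some a -> X != fset0.
Proof. by move=> Xa; apply/eqP => X0; rewrite X0 pjoin0 in Xa. Qed.

Lemma pmeet_neq0 X a : pmeet X = Some a -> X != fset0.
Proof. by move=> Xa; apply/eqP => X0; rewrite X0 pmeet0 in Xa. Qed.

Lemma pjoin_ub X a x : pjoin X = Some a -> x \in X -> x <= a.
Proof.
move=> /pjoinP Xa xX.
have : [set p | a <= p] a by rewrite /=.
by rewrite Xa => /(_ x xX).
Qed.

Lemma pmeet_lb X a x : pmeet X = Some a -> x \in X -> a <= x.
Proof.
move=> /pmeetP Xa xX.
have : [set p | p <= a] a by rewrite /=.
by rewrite Xa => /(_ x xX).
Qed.

Lemma imfset_neq0 (f : P -> L) X : X != fset0 -> (f @` X)%fset != fset0.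
Proof.
by case/fset0Pn => x xX; apply/fset0Pn; exists (f x); exact: in_imfset.
Qed.

(** Operations of the target are total on nonempty sets, so preservation reduces to one inequality
    per relation: isotonicity already makes [f a] an upper (resp. lower) bound of the image. *)
Lemma plat_homI f : {homo f : x y / x <= y} ->
  (forall X a p, pjoin X = Some a ->
     (forall x, x \in X -> f x <= p) -> f a <= p) ->
  (forall X a p, pmeet X = Some a ->
     (forall x, x \in X -> p <= f x) -> p <= f a) ->
  plat_hom f.
Proof.
move=> fm fj fM; split=> // X a Xa.
  apply: lat_join_lub; first exact/imfset_neq0/pjoin_neq0/Xa.
  move=> p; split=> [fap _ /imfsetP[x xX ->]|fXp].
    by apply: le_trans fap; exact/fm/(pjoin_ub Xa).
  by apply: fj Xa _ => x xX; apply: fXp; exact: in_imfset.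
apply: lat_meet_glb; first exact/imfset_neq0/pmeet_neq0/Xa.
move=> p; split=> [fap _ /imfsetP[x xX ->]|fXp].
  by apply: le_trans fap _; exact/fm/(pmeet_lb Xa).
by apply: fM Xa _ => x xX; apply: fXp; exact: in_imfset.
Qed.

Lemma plat_hom_join_le f X a p : plat_hom f -> pjoin X = Some a ->
  (forall x, x \in X -> f x <= p) -> f a <= p.
Proof.
move=> [_ fj _] /fj/pjoinP fXa fXp.
suff : [set q | f a <= q] p by [].
by rewrite fXa => _ /= /imfsetP[x xX ->]; exact: fXp.
Qed.

Lemma plat_hom_meet_le f X a p : plat_hom f -> pmeet X = Some a ->
  (forall x, x \in X -> p <= f x) -> p <= f a.
Proof.
move=> [_ _ fm] /fm/pmeetP fXa fXp.
suff : [set q | q <= f a] p by [].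
by rewrite fXa => _ /= /imfsetP[x xX ->]; exact: fXp.
Qed.

(** Folding over the enumeration of [X] itself, not of its image, makes inductions on the joinands
    and pointwise computation of the join possible. *)
Lemma plat_hom_foldr_join f X a x s : plat_hom f -> pjoin X = Some a ->
  enum_fset X = x :: s -> f a = foldr Order.join (f x) (map f s).
Proof.
move=> fh Xa XE; apply/le_anti/andP; split.
  apply: plat_hom_join_le fh Xa _ => y.
  rewrite -[y \in X]/(y \in enum_fset X) XE => ys.
  by apply: le_foldr_join; rewrite -map_cons map_f.
rewrite foldr_joinE -map_cons -XE; apply/allP => _ /mapP[y yX ->].
by case: fh => fm _ _; exact/fm/(pjoin_ub Xa).
Qed.

Lemma plat_hom_foldr_meet f X a x s : plat_hom f -> pmeet X = Some a ->
  enum_fset X = x :: s -> f a = foldr Order.meet (f x) (map f s).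
Proof.
move=> fh Xa XE; apply/le_anti/andP; split; last first.
  apply: plat_hom_meet_le fh Xa _ => y.
  rewrite -[y \in X]/(y \in enum_fset X) XE => ys.
  by apply: ge_foldr_meet; rewrite -map_cons map_f.
rewrite foldr_meetE -map_cons -XE; apply/allP => _ /mapP[y yX ->].
by case: fh => fm _ _; exact/fm/(pmeet_lb Xa).
Qed.

End HomToLattice.

(** * Ideals and finitary weak distributivity *)

Section IdealFacts.
Import Order.LTheory.
Local Open Scope order_scope.
Context {d : Order.disp_t}.

Lemma is_idealI (L : latticeType d) (I : set L) : I !=set0 ->
  (forall x y, x <= y -> I y -> I x) ->
  (forall x y, I x -> I y -> I (x `|` y)) -> is_ideal I.
Proof.
move=> I0 Ile IU; split=> // x y; split=> [Ixy|[]]; last exact: IU.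
by split; [apply: Ile Ixy; exact: leUl | apply: Ile Ixy; exact: leUr].
Qed.

Lemma join_morphism_homo (L K : latticeType d) (h : L -> K) :
  Order.join_morphism h -> {homo h : x y / x <= y}.
Proof. by move=> hU x y /join_r xy; rewrite -xy hU leUl. Qed.

Lemma foldr_join_in (L : latticeType d) (I : set L) (x : L) s :
  (forall x y, I x -> I y -> I (x `|` y)) ->
  (forall y, y \in x :: s -> I y) -> I (foldr Order.join x s).
Proof.
move=> IU; elim: s => [|y s IH] Is /=; first by apply: Is; rewrite mem_head.
apply: IU; first by apply: Is; rewrite !inE eqxx orbT.
by apply: IH => z; rewrite inE => /orP[/eqP->|zs]; apply: Is;
  rewrite !inE ?eqxx ?zs ?orbT.
Qed.

(* The finitary form of weak distributivity, phrased with an ideal so as to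
   avoid choosing the summands. *)
Lemma weakly_distributive_foldr (L K : latticeType d) (h : L -> K)
    (J : Id L) (y : K) s : weakly_distributive h ->
  (forall z, z \in y :: s -> forall l, h l <= z -> ideal_set J l) ->
  forall l, h l <= foldr Order.join y s -> ideal_set J l.
Proof.
move=> hwd; elim: s => [|z s IH] Js l /=; first by apply: Js; rewrite mem_head.
move=> /hwd[l0 [l1 [ll l0z l1s]]]; apply: ideal_le ll _; apply: ideal_join.
  by apply: Js l0z; rewrite !inE eqxx orbT.
apply: IH l1s => w; rewrite inE => /orP[/eqP->|ws]; apply: Js;
  by rewrite !inE ?eqxx ?ws ?orbT.
Qed.

(** This is the join half of the claim that [x |-> {l | h l <= f x}] is a homomorphism into the
    ideal lattice: [J] stands for any ideal above the sets attached to the elements of [X]. *)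
Lemma weakly_distributive_pjoin d' (P : partialLattice d')
    (L K : latticeType d) (h : L -> K) (f : P -> plat_of_lattice K)
    (J : Id L) X a : weakly_distributive h -> plat_hom f ->
  pjoin X = Some a ->
  (forall x, x \in X -> forall l, h l <= f x -> ideal_set J l) ->
  forall l, h l <= f a -> ideal_set J l.
Proof.
move=> hwd fh Xa XJ l; have := pjoin_neq0 Xa.
case E: (enum_fset X) => [|x s].
  by case/fset0Pn => x; rewrite -[x \in X]/(x \in enum_fset X) E.
move=> _; rewrite (plat_hom_foldr_join fh Xa E).
apply: weakly_distributive_foldr => // z; rewrite -map_cons => /mapP[y + ->].
by rewrite -E; exact: XJ.
Qed.

End IdealFacts.

(** * Implications that need no closure property of the class *)

Section Implications.
Import Order.LTheory.
Local Open Scope order_scope.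
Context {d d' : Order.disp_t} (C : latticeType d -> Prop)
  (P : partialLattice d').

Lemma ideal_projective_wDj :
  ideal_projective P C -> projective P (@wDj d) C.
Proof.
move=> Pip K L h f CK CL [hs hU hwd] fh.
have hm := join_morphism_homo hU.
have [f0 f0E] := choice (fun x => hs (f x)).
have I x : is_ideal [set l | h l <= f x].
  apply: is_idealI => [|u v uv vx|u v /= ux vx].
  - by exists (f0 x); rewrite /= f0E.
  - by apply: le_trans vx; exact: hm.
  - by rewrite hU leUx ux.
pose phi x : Id L := Ideal (I x).
have phih : plat_hom (phi : P -> plat_of_lattice (Id L)).
  have [fm _ _] := fh.
  apply: plat_homI => [x y xy|X a J Xa XJ|X a J Xa XJ].
  - by apply/asboolP => l /= lx; apply: le_trans lx _; exact: fm.
  - apply/asboolP => l /=.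
    apply: (weakly_distributive_pjoin hwd fh Xa) => x xX k kx.
    by have /asboolP := XJ _ xX; apply.
  - apply/asboolP => l Jl /=; apply: (plat_hom_meet_le fh Xa) => x xX.
    by have /asboolP := XJ _ xX; apply.
have f0c : choice_function phi f0 by move=> x; rewrite inE /= f0E.
have [g [gc gh f0g]] := Pip L phi f0 CL phih f0c.
(* Membership of [g x] in [phi x] bounds [h (g x)] above by [f x]; domination of [f0], a lifting of
   [f] along [h] as a mere map, bounds it below. *)
exists g; split=> //; apply: funext => x /=; apply/le_anti/andP; split.
  by rewrite -f0E; exact: hm.
by have := gc x; rewrite inE.
Qed.

Lemma projective_wD : projective P (@wDj d) C -> projective P (@wD d) C.
Proof. by move=> Pp K L h f CK CL [hs [hU _] hwd]; exact: Pp. Qed.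

Lemma sharply_transferable_transferable :
  sharply_transferable P C -> transferable P C.
Proof.
move=> Pst L CL [phi phie]; have [f [fc fh fs]] := Pst L phi CL phie.
exists f; split=> // a b fab; apply: fs; rewrite inE.
by apply: ideal_le fab _; have := fc b; rewrite inE.
Qed.

(** When [x <= y] fails, the embedding yields an element [w (x, y)] of [phi x] outside [phi y]. As
    [P] is finite, [f0 x] can join all these witnesses for [x] and stay in [phi x]. Any choice
    function above [f0] is then sharp: if [f x] lies in [phi y], so does [w (x, y)]. *)
Lemma ideal_projective_sharply_transferable : finite_set [set: P] ->
  ideal_projective P C -> sharply_transferable P C.
Proof.
move=> /finite_fsetP[F FE] Pip L phi CL [phih phie].
have memF y : y \in F by have : [set` F] y by rewrite -FE.
have /choice[w wE] (xy : P * P) : exists l, ideal_set (phi xy.1) l /\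
    (ideal_set (phi xy.2) l -> xy.1 <= xy.2).
  case: xy => x y /=; have [[l xl] _] := idealP (phi x).
  have [xy|nxy] := boolP (x <= y); first by exists l.
  apply: contrapT => /forallNP nw; move/negP: nxy; apply; apply: phie.
  apply/asboolP => m xm; apply: contrapT => ym; apply: (nw m); split => //.
(* [w (x, x)] merely seeds the fold; it lies in [phi x] like the other terms. *)
pose f0 x := foldr Order.join (w (x, x)) [seq w (x, y) | y <- enum_fset F].
have f0c : choice_function phi f0.
  move=> x; rewrite inE; apply: foldr_join_in; first exact: ideal_join.
  move=> z; rewrite inE => /orP[/eqP->|/mapP[y _ ->]].
    by case: (wE (x, x)).
  by case: (wE (x, y)).
have [f [fc fh f0f]] := Pip L phi f0 CL phih f0c.
exists f; split=> // x y; rewrite inE => fxy.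
have [_ /= ] := wE (x, y); apply; apply: ideal_le fxy.
apply: le_trans (f0f x); apply: le_foldr_join.
by rewrite inE (map_f (fun y => w (x, y)) (memF y)) orbT.
Qed.

End Implications.

(** * Composition, and lattice homomorphisms as homomorphisms of partial lattices *)

Section PlatHomFacts.
Import Order.LTheory.
Local Open Scope order_scope.

Lemma plat_hom_comp {d1 d2 d3 : Order.disp_t} (P : partialLattice d1)
    (Q : partialLattice d2) (R : partialLattice d3) (f : P -> Q) (g : Q -> R) :
  plat_hom f -> plat_hom g -> plat_hom (g \o f).
Proof.
move=> [fm fj fM] [gm gj gM]; split=> [x y xy|X a Xa|X a Xa].
- exact/gm/fm.
- by rewrite (imfset_comp _ f g); apply/gj/fj.
- by rewrite (imfset_comp _ f g); apply/gM/fM.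
Qed.

Lemma plat_hom_lattice_hom {d : Order.disp_t} (L K : latticeType d)
    (f : plat_of_lattice L -> plat_of_lattice K) :
  plat_hom f -> lattice_hom (f : L -> K).
Proof.
move=> fh; have [fm _ _] := fh.
have xy0 (x y : L) : [fset x; y]%fset != fset0.
  by apply/fset0Pn; exists x; rewrite !inE eqxx.
split=> x y; apply/le_anti/andP; split.
- have xyj : lat_join [fset x; y]%fset = Some (x `|` y).
    apply: lat_join_lub => // p; rewrite leUx; split=> [/andP[xp yp] z|xyp].
      by rewrite !inE => /orP[] /eqP->.
    by rewrite !xyp // !inE eqxx ?orbT.
  apply: (plat_hom_join_le fh xyj) => z; rewrite !inE.
  by case/orP=> /eqP->; [exact: leUl|exact: leUr].
- by rewrite leUx !fm ?leUl ?leUr.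
- by rewrite lexI !fm ?leIl ?leIr.
- have xym : lat_meet [fset x; y]%fset = Some (x `&` y).
    apply: lat_meet_glb => // p; rewrite lexI; split=> [/andP[xp yp] z|xyp].
      by rewrite !inE => /orP[] /eqP->.
    by rewrite !xyp // !inE eqxx ?orbT.
  apply: (plat_hom_meet_le fh xym) => z; rewrite !inE.
  by case/orP=> /eqP->; [exact: leIl|exact: leIr].
Qed.

Lemma lattice_hom_plat_hom {d : Order.disp_t} (L K : latticeType d)
    (f : L -> K) :
  lattice_hom f -> plat_hom (f : plat_of_lattice L -> plat_of_lattice K).
Proof.
move=> [fU fI]; apply: plat_homI => [|X a p|X a p].
- exact: join_morphism_homo.
- rewrite /= /lat_join; case E: (enum_fset X) => [//|x s] [<-] fp.
  have -> : f (foldr Order.join x s) = foldr Order.join (f x) (map f s).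
    by elim: s {E} => //= y s <-; rewrite fU.
  rewrite foldr_joinE -map_cons -E; apply/allP => _ /mapP[y yX ->].
  exact: fp.
- rewrite /= /lat_meet; case E: (enum_fset X) => [//|x s] [<-] fp.
  have -> : f (foldr Order.meet x s) = foldr Order.meet (f x) (map f s).
    by elim: s {E} => //= y s <-; rewrite fI.
  rewrite foldr_meetE -map_cons -E; apply/allP => _ /mapP[y yX ->].
  exact: fp.
Qed.

End PlatHomFacts.

(** * Sublattices carved out by a predicate *)

Section SublatticeType.
Import Order.LTheory.
Local Open Scope order_scope.
Context {d : Order.disp_t} (T : latticeType d) (S : pred T).

(* The closure proofs are phantom arguments, from which the lattice structure is
   inferred. *)
Definition sublattice_of of {in S &, forall u v, u `&` v \in S}
  & {in S &, forall u v, u `|` v \in S} : Type := {x | S x}.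

Context (SI : {in S &, forall u v, u `&` v \in S})
  (SU : {in S &, forall u v, u `|` v \in S}).
Local Notation U := (sublattice_of SI SU).

HB.instance Definition _ := [isSub of U for @sval T S].
HB.instance Definition _ := [Choice of U by <:].
HB.instance Definition _ :=
  Order.SubChoice_isSubLattice.Build d T S d U SI SU.

End SublatticeType.

(** * Lifting through a pullback by sharp transferability *)

Section SharplyTransferableProjective.
Import Order.LTheory.
Local Open Scope order_scope.
Context {d d' : Order.disp_t} (C : latticeType d -> Prop)
  (P : partialLattice d').

Lemma sharply_transferable_wD : plat_in_class P C -> closed_sublattices C ->
  closed_finite_products C -> sharply_transferable P C ->
  projective P (@wD d) C.
Proof.
move=> [P0 [CP0 [e [e' [eh e'h ee' e'e]]]]] Csub Cprod Pst.
move=> K L h f CK CL [hs [hU hI] hwd] fh.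
have hm := join_morphism_homo hU.
(* An empty [P] is treated apart: closure under sublattices applies only to an inhabited
   pullback. *)
have [p0|noP] := pselect (inhabited P); last first.
  have g (x : P) : L by case: (noP (inhabits x)).
  exists g; split; last by apply: funext => x; case: (noP (inhabits x)).
  by split=> [x|X a|X a]; [case: (noP (inhabits x))|case: (noP (inhabits a))
    |case: (noP (inhabits a))].
have [em _ _] := eh; have [e'm _ _] := e'h.
have [FU FI] : lattice_hom (f \o e' : P0 -> K).
  exact/plat_hom_lattice_hom/plat_hom_comp.
have [s sK] := choice hs.
(* Index [true] carries [P0], the copy of [P] in the class, and [false] carries [L]; [S] cuts out
   the pullback of [f \o e'] and [h]. *)
pose D (b : bool) : latticeType d := if b then P0 else L.
pose S : pred (prodLattice D) :=
  fun m => `[< f (e' (m true)) = h (m false) >].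
have SI : {in S &, forall u v, u `&` v \in S}.
  move=> u v /asboolP uS /asboolP vS; apply/asboolP.
  by have /= -> := FI (u true) (v true); rewrite uS vS -hI.
have SU : {in S &, forall u v, u `|` v \in S}.
  move=> u v /asboolP uS /asboolP vS; apply/asboolP.
  by have /= -> := FU (u true) (v true); rewrite uS vS -hU.
pose M : subLattice S d := sublattice_of SI SU.
pose fstM (m : M) : P0 := (val m) true.
pose sndM (m : M) : L := (val m) false.
have fstU (m n : M) : fstM (m `|` n) = fstM m `|` fstM n by [].
have sndU (m n : M) : sndM (m `|` n) = sndM m `|` sndM n by [].
have MP (m : M) : f (e' (fstM m)) = h (sndM m) by exact/asboolP/(valP m).
have leM (m n : M) : fstM m <= fstM n -> sndM m <= sndM n -> m <= n.
  by move=> mn1 mn2; rewrite -Order.le_val; apply/asboolP => -[].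
have fst_le (m n : M) : m <= n -> fstM m <= fstM n.
  by rewrite -Order.le_val => /asboolP; apply.
have pairM q l : f (e' q) = h l -> exists m : M, fstM m = q /\ sndM m = l.
  move=> ql.
  pose m : prodLattice D := fun b => if b as b return D b then q else l.
  have mS : S m by exact/asboolP.
  by exists (Sub m mS); rewrite /fstM /sndM !SubK.
have /choice[c cP] p : exists m : M, fstM m = e p /\ sndM m = s (f p).
  by apply: pairM; rewrite ee' sK.
have I p : is_ideal [set m : M | fstM m <= e p].
  apply: is_idealI => [|u v uv /= |u v /= up vp].
  - by exists (c p); rewrite /= (cP p).1.
  - by apply: le_trans; exact: fst_le.
  - by rewrite fstU leUx up.
pose phi p : Id M := Ideal (I p).
have phie : plat_embedding (phi : P -> plat_of_lattice (Id M)).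
  split=> [|p p' /asboolP/(_ (c p))]; last first.
    by rewrite /= (cP p).1 => /(_ (lexx _))/e'm; rewrite !ee'.
  apply: plat_homI => [x y xy|X a J Xa XJ|X a J Xa XJ].
  - by apply/asboolP => m /= mx; apply: le_trans mx _; exact: em.
  (* The two coordinates of [m] are bounded separately, by those of elements [j1] and [j2] of [J].
     Since the order of [M] is componentwise, [m] lies below the join of [j1] and [j2], hence in
     [J]. *)
  - apply/asboolP => m /= ma.
    have cJ x : x \in X -> ideal_set J (c x).
      by move=> /XJ/asboolP; apply; rewrite /= (cP x).1.
    have [[j0 Jj0] _] := idealP J.
    have J1i : is_ideal [set q : P0 | exists2 j, ideal_set J j & q <= fstM j].
      apply: is_idealI => [|u v uv [j Jj vj]|u v [j Jj uj] [k Jk vk]].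
      - by exists (fstM j0), j0.
      - by exists j => //; exact: le_trans vj.
      - by exists (j `|` k); [exact: ideal_join|rewrite fstU leU2].
    have J2i : is_ideal [set l : L | exists2 j, ideal_set J j & l <= sndM j].
      apply: is_idealI => [|u v uv [j Jj vj]|u v [j Jj uj] [k Jk vk]].
      - by exists (sndM j0), j0.
      - by exists j => //; exact: le_trans vj.
      - by exists (j `|` k); [exact: ideal_join|rewrite sndU leU2].
    have [j1 Jj1 mj1] : exists2 j, ideal_set J j & fstM m <= fstM j.
      (* The identity is weakly distributive, so the first coordinate falls under the same lemma as
         the second. *)
      apply: (weakly_distributive_pjoin (h := id) (J := Ideal J1i) _ eh Xa) => //.
        by move=> x y0 y1 xy; exists y0, y1.
      by move=> x xX l lx; exists (c x); [exact: cJ|rewrite (cP x).1].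
    have [j2 Jj2 mj2] : exists2 j, ideal_set J j & sndM m <= sndM j.
      apply: (weakly_distributive_pjoin (J := Ideal J2i) hwd fh Xa).
        move=> x xX l lx.
        (* Only [h l <= f x] is known, so [l] itself may not pair with [e x]; joining it with the
           preimage [s (f x)] makes the image exactly [f x]. *)
        have [k [k1 k2]] : exists k : M, fstM k = e x /\ sndM k = l `|` s (f x).
          by apply: pairM; rewrite ee' hU sK join_r.
        exists k; last by rewrite k2 leUl.
        by have /asboolP := XJ _ xX; apply; rewrite /= k1.
      by rewrite -MP -[f a](congr1 f (ee' a)); exact: (join_morphism_homo FU).
    apply: (@ideal_le _ _ J _ (j1 `|` j2)); last exact: ideal_join.
    apply: leM; first by rewrite fstU; apply: le_trans mj1 _; exact: leUl.
    by rewrite sndU; apply: le_trans mj2 _; exact: leUr.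
  - apply/asboolP => m Jm /=; apply: (plat_hom_meet_le eh Xa) => x xX.
    by have /asboolP := XJ _ xX; apply.
have CM : C M.
  apply: (Csub (prodLattice D) S M).
    by apply: (Cprod bool D) => [|[]]; rewrite ?card_bool.
  by case: p0 => p; exact: (inhabits (c p)).
have [g [gc gh gs]] := Pst M phi CM phie.
(* The choice property gives one inequality. For the other, [g x] lies in the ideal of [phi] at
   [e' (fstM (g x))], so sharpness puts [x] below that element. *)
have gE x : fstM (g x) = e x.
  apply/le_anti/andP; split; first by have := gc x; rewrite inE.
  rewrite -[fstM (g x)]e'e; apply/em/gs; rewrite inE /=.
  by rewrite e'e.
exists (sndM \o g); split; last first.
  by apply: funext => x /=; rewrite -MP gE ee'.
by apply: plat_hom_comp gh _; exact: lattice_hom_plat_hom.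
Qed.
End SharplyTransferableProjective.

(** * Finite quantification and filters *)

Lemma filter_forall_finite (T : choiceType) (I : Type) (U : set_system I)
    (A : T -> set I) : Filter U -> finite_set [set: T] ->
  (forall t, U (A t)) -> U [set i | forall t, A t i].
Proof.
move=> FU /finite_fsetP[F FE] UA.
apply: filterS (filter_bigI (D := F) FU (fun t _ => UA t)) => i Ai t.
by apply: Ai; rewrite -FE.
Qed.

Lemma finite_set_fset (T : choiceType) :
  finite_set [set: T] -> finite_set [set: {fset T}].
Proof.
move=> /finite_fsetP[F FE].
apply: sub_finite_set (finite_fset (fpowerset F)) => X _ /=.
rewrite fpowersetE; apply/fsubsetP => x _.
by have : [set` F] x by rewrite -FE.
Qed.

(** * The isotone part of an ultrapower and its map onto the ideal lattice *)

Section IsotoneUltrapower.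
Import Order.LTheory.
Local Open Scope order_scope.
Local Open Scope quotient_scope.
Context {d : Order.disp_t} (L : latticeType d).
Variables (U : set_system {fset L}) (FU : UltraFilter U).
Hypothesis Ucone : forall i, U [set j | (i `<=` j)%fset].

Let D (_ : {fset L}) : latticeType d := L.
Let W : latticeType d := ultraproduct FU D.
Let FF : Filter U. Proof. exact: _. Qed.
Implicit Types (x y : prodLattice D) (A B : Id L).

Definition ultra_pi x : W := \pi_(ultraproduct FU D) x.

Lemma ultra_pi_le x y : (ultra_pi x <= ultra_pi y) <-> U [set i | x i <= y i].
Proof.
have xE := ultra_repr FU x; have yE := ultra_repr FU y.
split=> [/asboolP xy|xy]; last apply/asboolP.
  by apply: filterS3 xE yE xy => i /= -> ->.
by apply: filterS3 xE yE xy => i /= -> ->.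
Qed.

Lemma ultra_pi_join x y : ultra_pi (x `|` y) = ultra_pi x `|` ultra_pi y.
Proof.
apply/ultra_piP; have xE := ultra_repr FU x; have yE := ultra_repr FU y.
by apply: filterS2 xE yE => i /= xE yE; rewrite /Order.join /= /prod_join xE yE.
Qed.

Lemma ultra_pi_meet x y : ultra_pi (x `&` y) = ultra_pi x `&` ultra_pi y.
Proof.
apply/ultra_piP; have xE := ultra_repr FU x; have yE := ultra_repr FU y.
by apply: filterS2 xE yE => i /= xE yE; rewrite /Order.meet /= /prod_meet xE yE.
Qed.

Definition isotone x := forall i j : {fset L}, (i `<=` j)%fset -> x i <= x j.

Definition isotone_class : pred W :=
  fun u => `[< exists2 x, isotone x & u = ultra_pi x >].

Lemma isotone_classI :
  {in isotone_class &, forall u v, u `&` v \in isotone_class}.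
Proof.
move=> _ _ /asboolP[x xm ->] /asboolP[y ym ->]; apply/asboolP.
by exists (x `&` y); [move=> i j ij; exact: leI2 (xm _ _ ij) (ym _ _ ij)
  |rewrite ultra_pi_meet].
Qed.

Lemma isotone_classU :
  {in isotone_class &, forall u v, u `|` v \in isotone_class}.
Proof.
move=> _ _ /asboolP[x xm ->] /asboolP[y ym ->]; apply/asboolP.
by exists (x `|` y); [move=> i j ij; exact: leU2 (xm _ _ ij) (ym _ _ ij)
  |rewrite ultra_pi_join].
Qed.

Definition isotone_ultrapower : subLattice isotone_class d :=
  sublattice_of isotone_classI isotone_classU.
Local Notation M := isotone_ultrapower.
Implicit Types m n : M.

Lemma isotone_rep m : exists x, isotone x /\ val m = ultra_pi x.
Proof. by have /asboolP[x xm mx] := valP m; exists x. Qed.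

(** Unlike [repr], this representative is isotone at all indices, not just on a set of [U]. *)
Definition irep m : prodLattice D := projT1 (cid (isotone_rep m)).

Lemma irep_isotone m : isotone (irep m).
Proof. by rewrite /irep; case: cid => x []. Qed.

Lemma irepE m : val m = ultra_pi (irep m).
Proof. by rewrite /irep; case: cid => x []. Qed.

Lemma isotone_elt x : isotone x -> exists m, val m = ultra_pi x.
Proof.
move=> xm; have xS : isotone_class (ultra_pi x) by apply/asboolP; exists x.
by exists (Sub (ultra_pi x) xS); rewrite SubK.
Qed.

Lemma is_ideal_below m : is_ideal [set a : L | exists i, a <= irep m i].
Proof.
have mm := @irep_isotone m.
apply: is_idealI => [|u v uv [i vi]|u v [i ui] [j vj]].
- by exists (irep m fset0), fset0.
- by exists i; exact: le_trans vi.
- exists (i `|` j)%fset; rewrite leUx; apply/andP; split.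
    by apply: le_trans ui _; exact/mm/fsubsetUl.
  by apply: le_trans vj _; exact/mm/fsubsetUr.
Qed.

Definition below m : Id L := Ideal (is_ideal_below m).

(** The ideal is independent of the isotone representative: two of them agree on a set of [U], which
    meets the cone over any [i], and isotonicity carries a bound at [i] up to an index where they
    agree. *)
Lemma belowP m x (a : L) : isotone x -> val m = ultra_pi x ->
  ideal_set (below m) a <-> exists i, a <= x i.
Proof.
have mm := @irep_isotone m.
move=> xm; rewrite irepE => /ultra_piP mx.
split=> -[i ai].
  have [j [/= mxj ij]] := filter_ex (filterI mx (Ucone i)).
  by exists j; rewrite -mxj; apply: le_trans ai _; exact: mm.
have [j [/= mxj ij]] := filter_ex (filterI mx (Ucone i)).
by exists j; rewrite mxj; apply: le_trans ai _; exact: xm.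
Qed.

Lemma below_surjective : surjective below.
Proof.
move=> A; have [[a0 Aa0] _] := idealP A.
(* Join of the elements of [i] lying in [A], together with [a0] so that the join is never empty.
   Each [a] in [A] is reached at the index consisting of [a] alone. *)
pose x : prodLattice D := fun i : {fset L} =>
  foldr Order.join a0 [seq a <- enum_fset i | `[< ideal_set A a >]].
have xm : isotone x.
  move=> i j ij; rewrite /x foldr_joinE; apply/allP => a.
  rewrite inE mem_filter => /orP[/eqP->|/andP[Aa ai]]; apply: le_foldr_join.
    exact: mem_head.
  by rewrite inE mem_filter Aa (fsubsetP ij _ ai) orbT.
have [m mx] := isotone_elt xm; exists m.
apply/ideal_inj/seteqP; split=> a.
  move=> /(belowP _ xm mx)[i ai]; apply: ideal_le ai _.
  apply: foldr_join_in; first exact: ideal_join.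
  by move=> b; rewrite inE mem_filter => /orP[/eqP->|/andP[/asboolP]].
move=> Aa; apply/(belowP _ xm mx); exists [fset a]%fset.
apply: le_foldr_join; rewrite inE mem_filter; apply/orP; right.
apply/andP; split; first exact/asboolP.
by rewrite -[_ \in _]/(a \in [fset a]%fset) inE.
Qed.

Lemma below_le m A :
  (below m <= A) <-> forall i, ideal_set A (irep m i).
Proof.
split=> [/asboolP mA i|mA]; first by apply: mA; exists i.
by apply/asboolP => a [i ai]; exact: ideal_le ai (mA i).
Qed.

(** By [belowP] the pointwise join of the representatives computes the ideal; bounds found at [i]
    and at [j] hold together at their union by isotonicity. The meet is handled alike. *)
Lemma below_join : Order.join_morphism below.
Proof.
move=> m n; have [mm nm] := (@irep_isotone m, @irep_isotone n).
have jm : isotone (irep m `|` irep n).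
  by move=> i j ij; exact: leU2 (mm _ _ ij) (nm _ _ ij).
have jE : val (m `|` n) = ultra_pi (irep m `|` irep n).
  by rewrite ultra_pi_join -!irepE.
apply/ideal_inj/seteqP; split=> a.
  move=> /(belowP _ jm jE)[i ai]; exists (irep m i), (irep n i).
  by split=> //; exists i.
move=> [u [v [[i ui] [j vj] auv]]]; apply/(belowP _ jm jE).
exists (i `|` j)%fset; apply: le_trans auv _; apply: leU2.
  by apply: le_trans ui _; exact/mm/fsubsetUl.
by apply: le_trans vj _; exact/nm/fsubsetUr.
Qed.

Lemma below_meet : Order.meet_morphism below.
Proof.
move=> m n; have [mm nm] := (@irep_isotone m, @irep_isotone n).
have jm : isotone (irep m `&` irep n).
  by move=> i j ij; exact: leI2 (mm _ _ ij) (nm _ _ ij).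
have jE : val (m `&` n) = ultra_pi (irep m `&` irep n).
  by rewrite ultra_pi_meet -!irepE.
apply/ideal_inj/seteqP; split=> a.
  move=> /(belowP _ jm jE)[i ai]; split; exists i; apply: le_trans ai _.
    exact: leIl.
  exact: leIr.
move=> [[i ui] [j vj]]; apply/(belowP _ jm jE).
exists (i `|` j)%fset; apply: le_trans (_ : a <= irep m i `&` irep n j) _.
  by rewrite lexI ui.
by apply: leI2; [exact/mm/fsubsetUl|exact/nm/fsubsetUr].
Qed.

(* Joining the values of [a] over all subsets of [i] makes [a] isotone while
   staying in the ideal. *)
Lemma isotone_majorant A (a : {fset L} -> L) : (forall i, ideal_set A (a i)) ->
  exists2 x, isotone x & forall i, a i <= x i /\ ideal_set A (x i).
Proof.
move=> aA.
exists (fun i =>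
    foldr Order.join (a i) [seq a j | j <- enum_fset (fpowerset i)]).
  move=> i k ik; rewrite foldr_joinE; apply/allP => b.
  suff ak j : (j `<=` k)%fset ->
      a j \in a k :: [seq a j | j <- enum_fset (fpowerset k)].
    rewrite inE => /orP[/eqP->|/mapP[j + ->]].
      exact/le_foldr_join/ak.
    rewrite -[_ \in _]/(j \in fpowerset i) fpowersetE => ji.
    exact/le_foldr_join/ak/(fsubset_trans ji).
  move=> jk; rewrite inE map_f ?orbT //.
  by rewrite -[_ \in _]/(j \in fpowerset k) fpowersetE.
move=> i; split; first by apply: le_foldr_join; exact: mem_head.
apply: foldr_join_in; first exact: ideal_join.
by move=> b; rewrite inE => /orP[/eqP->|/mapP[j _ ->]].
Qed.

(** At each index the representative of [m] splits as a bound [a i] in [A] joined with [b i] in [B].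
    These choices need not be isotone in [i], so they are replaced by isotone majorants within the
    same ideals. *)
Lemma below_weakly_distributive : weakly_distributive below.
Proof.
move=> m A B /below_le mAB.
have /choice[a aP] i : exists a, exists b,
  [/\ ideal_set A a, ideal_set B b & irep m i <= a `|` b] by exact: mAB.
have /choice[b bP] := aP.
have [x xm xP] : exists2 x, isotone x &
    forall i, a i <= x i /\ ideal_set A (x i).
  by apply: isotone_majorant => i; case: (bP i).
have [y ym yP] : exists2 y, isotone y &
    forall i, b i <= y i /\ ideal_set B (y i).
  by apply: isotone_majorant => i; case: (bP i).
have [m0 m0E] := isotone_elt xm; have [m1 m1E] := isotone_elt ym.
exists m0, m1; split.
- rewrite -Order.le_val.
  have -> : val (m0 `|` m1) = ultra_pi (x `|` y).
    by rewrite ultra_pi_join -m0E -m1E.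
  rewrite irepE; apply/ultra_pi_le; apply: filterE => i /=.
  have [_ _ mi] := bP i; apply: le_trans mi _; apply: leU2.
    by case: (xP i).
  by case: (yP i).
- apply/asboolP => c /(belowP _ xm m0E)[i ci]; apply: ideal_le ci _.
  by case: (xP i).
- apply/asboolP => c /(belowP _ ym m1E)[i ci]; apply: ideal_le ci _.
  by case: (yP i).
Qed.

Lemma below_wD : wD below.
Proof.
split; [exact: below_surjective| |exact: below_weakly_distributive].
by split; [exact: below_join|exact: below_meet].
Qed.

(** An equation between a class and a finite join of classes holds pointwise on a set of [U]. Where
    the join of [X] is undefined the condition is vacuous, so it can be imposed for all [X] at
    once. *)
Lemma irep_join_near d' (P : partialLattice d') (g : P -> plat_of_lattice M)
    (X : {fset P}) :
  plat_hom g -> U [set i | forall a, pjoin X = Some a -> forall p : L,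
    (forall x : P, x \in X -> irep (g x) i <= p) -> irep (g a) i <= p].
Proof.
move=> gh; case Xa: (pjoin X) => [a|]; last exact: filterE.
have := pjoin_neq0 Xa; case E: (enum_fset X) => [|x s] X0.
  by case/fset0Pn: X0 => x; rewrite -[x \in X]/(x \in enum_fset X) E.
have /(congr1 val) := plat_hom_foldr_join gh Xa E.
have -> : val (foldr Order.join (g x) (map g s)) =
    ultra_pi (foldr Order.join (irep (g x)) [seq irep (g y) | y : P <- s]).
  elim: s {E} => [|y s IH] /=; first exact: irepE.
  by rewrite ultra_pi_join -IH -irepE.
rewrite irepE => /ultra_piP; apply: filterS => i /= iE _ [<-] p Xp; rewrite iE.
have -> : foldr Order.join (irep (g x)) [seq irep (g y) | y : P <- s] i =
    foldr Order.join (irep (g x) i) [seq irep (g y) i | y : P <- s].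
  by elim: s {E iE} => //= y s <-.
rewrite foldr_joinE -(map_cons (fun y : P => irep (g y) i)) -E.
by apply/allP => _ /mapP[y yX ->]; exact: Xp.
Qed.

Lemma irep_meet_near d' (P : partialLattice d') (g : P -> plat_of_lattice M)
    (X : {fset P}) :
  plat_hom g -> U [set i | forall a, pmeet X = Some a -> forall p : L,
    (forall x : P, x \in X -> p <= irep (g x) i) -> p <= irep (g a) i].
Proof.
move=> gh; case Xa: (pmeet X) => [a|]; last exact: filterE.
have := pmeet_neq0 Xa; case E: (enum_fset X) => [|x s] X0.
  by case/fset0Pn: X0 => x; rewrite -[x \in X]/(x \in enum_fset X) E.
have /(congr1 val) := plat_hom_foldr_meet gh Xa E.
have -> : val (foldr Order.meet (g x) (map g s)) =
    ultra_pi (foldr Order.meet (irep (g x)) [seq irep (g y) | y : P <- s]).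
  elim: s {E} => [|y s IH] /=; first exact: irepE.
  by rewrite ultra_pi_meet -IH -irepE.
rewrite irepE => /ultra_piP; apply: filterS => i /= iE _ [<-] p Xp; rewrite iE.
have -> : foldr Order.meet (irep (g x)) [seq irep (g y) | y : P <- s] i =
    foldr Order.meet (irep (g x) i) [seq irep (g y) i | y : P <- s].
  by elim: s {E iE} => //= y s <-.
rewrite foldr_meetE -(map_cons (fun y : P => irep (g y) i)) -E.
by apply/allP => _ /mapP[y yX ->]; exact: Xp.
Qed.

(** Finiteness of [P] leaves finitely many conditions, each true on a set of [U]; any index in their
    intersection gives the required map by evaluation. *)
Lemma below_lift d' (P : partialLattice d') (g : P -> plat_of_lattice M)
    (f0 : P -> L) : finite_set [set: P] -> plat_hom g ->
  choice_function (below \o g) f0 ->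
  exists f : P -> plat_of_lattice L,
    [/\ choice_function (below \o g) f, plat_hom f & forall x : P, f0 x <= f x].
Proof.
move=> Pfin gh f0c; have Pfin2 := finite_set_fset Pfin.
have [gm _ _] := gh.
have near_le :
    U [set i | forall x y : P, x <= y -> irep (g x) i <= irep (g y) i].
  apply: (filter_forall_finite FF Pfin) => x.
  apply: (filter_forall_finite FF Pfin) => y.
  have [/gm xy|_] := boolP (x <= y); last exact: filterE.
  move: xy; rewrite -Order.le_val !irepE => /ultra_pi_le.
  by apply: filterS => i.
(* [f0 x] is bounded by the representative of [g x] at some index, hence throughout the cone over
   that index. *)
have near_f0 : U [set i | forall x : P, f0 x <= irep (g x) i].
  apply: (filter_forall_finite FF Pfin) => x.
  have := f0c x; rewrite inE => -[i f0i].
  apply: filterS (Ucone i) => j /= ij; apply: le_trans f0i _.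
  exact: irep_isotone.
have near_join := filter_forall_finite FF Pfin2 (fun X => irep_join_near X gh).
have near_meet := filter_forall_finite FF Pfin2 (fun X => irep_meet_near X gh).
have [i [[/= ile if0] [/= ij im]]] := filter_ex
  (filterI (filterI near_le near_f0) (filterI near_join near_meet)).
exists (fun x : P => irep (g x) i); split=> //.
  by move=> x; rewrite inE; exists i.
by apply: plat_homI => [x y|X a p Xa|X a p Xa];
  [exact: ile|exact: ij Xa p|exact: im Xa p].
Qed.

End IsotoneUltrapower.

(** Cones are nonempty, and the cone over a union is the intersection of the cones, so they generate
    a proper filter, which extends to an ultrafilter. *)
Lemma cone_ultrafilter (T : choiceType) : exists U : set_system {fset T},
  UltraFilter U /\ forall i, U [set j | (i `<=` j)%fset].
Proof.
pose cone (i : {fset T}) := [set j | (i `<=` j)%fset].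
have FF : Filter (filter_from setT cone).
  apply: filter_fromT_filter => [|i j]; first by exists fset0.
  by exists (i `|` j)%fset => k; rewrite /cone /= fsubUset => /andP.
have [|U [FU FsubU]] := @ultraFilterLemma _ (filter_from setT cone).
  by apply: filter_from_proper => i _; exists i; exact: fsubset_refl.
by exists U; split=> // i; apply: FsubU; exists i.
Qed.

(** * From projectivity for weakly distributive homomorphisms to ideal-projectivity *)

Section ProjectiveIdealProjective.
Import Order.LTheory.
Local Open Scope order_scope.
Context {d d' : Order.disp_t} (C : latticeType d -> Prop)
  (P : partialLattice d').

Lemma wD_projective_ideal_projective : finite_set [set: P] ->
  closed_sublattices C -> closed_wD_images C -> closed_ultraproducts C ->
  projective P (@wD d) C -> ideal_projective P C.
Proof.
move=> Pfin Csub CwD Cultra Pproj L phi f0 CL phih f0c.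
(* If [L] is empty, [f0] forces [P] to be empty. Otherwise the constant function at [a0] shows that
   the sublattice is inhabited. *)
have [[a0]|noL] := pselect (inhabited L); last first.
  have noP (x : P) : False by apply: noL; exact: (inhabits (f0 x)).
  by exists f0; split=> //; split=> [x|X a|X a]; [case: (noP x)|case: (noP a)
    |case: (noP a)].
have [U [FU Ucone]] := cone_ultrafilter L.
have hwD := below_wD FU Ucone.
have CM : C (isotone_ultrapower FU).
  apply: (Csub _ _ _ (Cultra _ U FU (fun=> L) (fun=> CL))).
  have [m _] : exists m : isotone_ultrapower FU, val m = ultra_pi FU (fun=> a0).
    by apply: isotone_elt => i j _; exact: lexx.
  exact: (inhabits m).
have CId : C (Id L) by exact: CwD CM hwD.
have [g [gh phiE]] := Pproj _ _ _ phi CId CM hwD phih.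
by subst phi; exact: below_lift.
Qed.

End ProjectiveIdealProjective.

Theorem theorem3p9 (d d' : Order.disp_t) (C : latticeType d -> Prop)
    (P : partialLattice d') (hC : abstract_class C) :
  let i := ideal_projective P C in
  let ii := projective P (@wDj d) C in
  let iii := projective P (@wD d) C in
  let iv := sharply_transferable P C in
  let v := transferable P C in
  [/\ (* (a) *) [/\ i -> ii, ii -> iii & iv -> v],
      (* (b) *) finite_set [set: P] -> closed_sublattices C ->
                closed_wD_images C -> closed_ultraproducts C -> iii -> i,
      (* (c) *) finite_set [set: P] -> i -> iv &
      (* (d) *) plat_in_class P C -> closed_sublattices C ->
                closed_finite_products C -> iv -> iii].
Proof.
split; first split.
- exact: ideal_projective_wDj.
- exact: projective_wD.
- exact: sharply_transferable_transferable.
- exact: wD_projective_ideal_projective.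
- exact: ideal_projective_sharply_transferable.
- exact: sharply_transferable_wD.
Qed.
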